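(* Let $R$ be an integral domain and $M$ an $R$-module. The following statements are equivalent: (i) $M$ is fusible. (ii) $M$ is regular fusible. (iii) $M$ is nonsingular. (iv) $M$ is torsion free.
   Context: An integral domain is a commutative ring with $1\neq 0$ and no nonzero zero divisors. For $m\in M$, $ann_R(m)=\{r\in R: mr=0\}$. $T_R(M)=\{m\in M: ann_R(m)\neq 0\}$ is the set of torsion elements, $T_R^{\star}(M)=\{m\in M: ann_R(m)=0\}$ the set of torsion free elements, and $Zd(M)=\{r\in R: mr=0\text{ for some }0\neq m\in M\}$. $M$ is torsion free if $T_R(M)=0$. An element of $M$ is fusible if it can be written as $x+y$ with $x\in T_R(M)$ and $y\in T_R^{\star}(M)$; $M$ is fusible if every nonzero element of $M$ is fusible. A nonzero $m\in M$ is regular fusible if there exists $r\in R-Zd(M)$ such that $mr$ is fusible; $M$ is regular fusible if every nonzero element of $M$ is regular fusible. An ideal $I$ of $R$ is essential, written $I\leq_e R$, if $I\cap J\neq 0$ for every nonzero ideal $J$ of $R$. $Z(M)=\{m\in M: ann_R(m)\leq_e R\}$, and $M$ is nonsingular if $Z(M)=0$. *)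

(* Defs.v *)
From mathcomp Require Import all_boot all_algebra.
From mathcomp Require Import boolp classical_sets.
Set Implicit Arguments.
Unset Strict Implicit.
Unset Printing Implicit Defensive.
Import GRing.Theory.
Local Open Scope ring_scope.
Local Open Scope classical_set_scope.

Section Ideals.
Variable R : comNzRingType.

(* Ideals are Prop-valued sets and may be improper, unlike those of
   ring_quotient, which are decidable and exclude 1. *)
Definition is_ideal (I : set R) : Prop :=
  [/\ I 0, (forall a b, I a -> I b -> I (a + b)) &
      (forall r a, I a -> I (r * a))].

Definition essential (I : set R) : Prop :=
  is_ideal I /\
  forall J : set R, is_ideal J -> J <> [set 0] -> I `&` J <> [set 0].

End Ideals.

(* R being commutative, the right action m r is written r *: m. *)
Section Modules.
Variables (R : comNzRingType) (M : lmodType R).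

Definition ann (m : M) : set R := [set r | r *: m = 0].

Definition torsion : set M := [set m | ann m <> [set 0]].

Definition torsion_free_elements : set M := [set m | ann m = [set 0]].

Definition zero_divisors : set R :=
  [set r | exists m : M, m <> 0 /\ r *: m = 0].

Definition singular : set M := [set m | essential (ann m)].

Definition fusible_element (m : M) : Prop :=
  exists x y : M, [/\ torsion x, torsion_free_elements y & m = x + y].

Definition regular_fusible_element (m : M) : Prop :=
  m <> 0 /\ exists r : R, (~` zero_divisors) r /\ fusible_element (r *: m).

End Modules.

Arguments torsion {R} M.
Arguments torsion_free_elements {R} M.
Arguments zero_divisors {R} M.
Arguments singular {R} M.

Definition fusible (R : comNzRingType) (M : lmodType R) : Prop :=
  forall m : M, m <> 0 -> fusible_element m.

Definition regular_fusible (R : comNzRingType) (M : lmodType R) : Prop :=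
  forall m : M, m <> 0 -> regular_fusible_element m.

Definition nonsingular (R : comNzRingType) (M : lmodType R) : Prop :=
  singular M = [set 0].

Definition torsion_free (R : comNzRingType) (M : lmodType R) : Prop :=
  torsion M = [set 0].

(* Main.v *)
Require Import Defs.
From mathcomp Require Import all_boot all_algebra.
From mathcomp Require Import boolp classical_sets.

Set Implicit Arguments.
Unset Strict Implicit.
Unset Printing Implicit Defensive.
Import GRing.Theory.
Local Open Scope ring_scope.
Local Open Scope classical_set_scope.

(** Over a domain the product of two nonzero scalars is nonzero, and this has
    two consequences that give all the equivalences.

    First, any two nonzero ideals meet nontrivially, so an annihilator is
    essential as soon as it is nonzero: the singular elements are exactly the
    torsion elements ([singular_torsion]), and being nonsingular is the same as
    being torsion free.

    Second, torsion elements form a subgroup, so the sum of a torsion element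
    and a torsion free element is never torsion ([fusible_not_torsion]).  Hence
    if some multiple [r *: m] is fusible, [m] is not torsion, for a scalar
    killing [m] kills [r *: m] too; a regular fusible module therefore has no
    nonzero torsion.  Conversely, in a torsion free module each nonzero [m] is
    fusible through [m = 0 + m]. *)

Lemma zero_set_neqP (V : nmodType) (I : set V) :
  I 0 -> I <> [set 0] <-> exists2 a, I a & a != 0.
Proof.
move=> I0; split=> [neqI0|[a Ia a_neq0] I_eq0]; last first.
  by move: Ia a_neq0; rewrite I_eq0 => /= ->; rewrite eqxx.
apply: contrapT => no_a; apply: neqI0; apply/seteqP; split=> [a Ia /=|_ /= ->//].
by apply/eqP; apply: contra_notT no_a => a_neq0; exists a.
Qed.

Section TorsionOverRing.
Variables (R : comNzRingType) (M : lmodType R).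

Lemma ann_ideal (m : M) : is_ideal (ann m).
Proof.
split=> [|a b /= am0 bm0|r a /= am0]; rewrite /ann /=.
- by rewrite scale0r.
- by rewrite scalerDl am0 bm0 addr0.
- by rewrite -scalerA am0 scaler0.
Qed.

Lemma torsionP (m : M) : torsion M m <-> exists2 a : R, a *: m = 0 & a != 0.
Proof. by apply: zero_set_neqP; case: (ann_ideal m). Qed.

Lemma torsion0 : torsion M 0.
Proof. by apply/torsionP; exists 1; rewrite ?scaler0 ?oner_eq0. Qed.

Lemma torsionZ (r : R) (m : M) : torsion M m -> torsion M (r *: m).
Proof.
by move=> /torsionP[a am0 a_neq0]; apply/torsionP; exists a;
  rewrite // scalerA mulrC -scalerA am0 scaler0.
Qed.

End TorsionOverRing.

Section TorsionOverDomain.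
Variables (R : idomainType) (M : lmodType R).

Lemma torsionB (x y : M) : torsion M x -> torsion M y -> torsion M (x - y).
Proof.
move=> /torsionP[a ax0 a_neq0] /torsionP[b by0 b_neq0].
apply/torsionP; exists (a * b); last by rewrite mulf_neq0.
by rewrite scalerBr {1}mulrC -!scalerA ax0 by0 !scaler0 subr0.
Qed.

(** If [x + y] and [x] were both torsion, so would be their difference [y]. *)
Lemma fusible_not_torsion (m : M) : fusible_element m -> ~ torsion M m.
Proof.
move=> [x [y [tx fy ->]]] txy.
by have := torsionB txy tx; rewrite addrC addKr; apply.
Qed.

(** A nonzero [a] killing [m] meets every nonzero ideal [J]: for nonzero [b] in
    [J], the product [b * a] lies in both ideals and is nonzero.  Conversely an
    essential ideal is nonzero because it meets the whole ring nontrivially. *)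
Lemma singular_torsion : singular M = torsion M.
Proof.
apply/seteqP; split=> m.
- move=> [_ ess] ann0.
  have /ess : is_ideal [set: R] by split.
  rewrite setIT; apply=> //.
  by apply/(zero_set_neqP I); exists 1; rewrite ?oner_eq0.
- move=> /torsionP[a am0 a_neq0]; split; first exact: ann_ideal.
  move=> J [J0 _ JM] /(zero_set_neqP J0)[b Jb b_neq0].
  apply/zero_set_neqP; first by split=> //; case: (ann_ideal m).
  exists (b * a); last by rewrite mulf_neq0.
  split; last by rewrite mulrC; exact: JM.
  by rewrite /ann /= -scalerA am0 scaler0.
Qed.

End TorsionOverDomain.

Theorem corollary3 (R : idomainType) (M : lmodType R) :
  [<-> fusible M; regular_fusible M; nonsingular M; torsion_free M].
Proof.
tfae.
- move=> fusM m m_neq0; split=> //; exists 1; rewrite scale1r.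
  by split; [case=> x [x_neq0]; rewrite scale1r | exact: fusM].
- move=> regM; rewrite /nonsingular singular_torsion.
  apply/seteqP; split=> [m tm /=|_ /= ->]; last exact: torsion0.
  apply: contrapT => /regM[_ [r [_ fus_rm]]].
  exact: (fusible_not_torsion fus_rm (torsionZ tm)).
- by rewrite /nonsingular singular_torsion.
- move=> tfM m m_neq0; exists 0, m; split; [exact: torsion0 | | by rewrite add0r].
  apply: contrapT => tm; apply: m_neq0.
  by have : torsion M m by []; rewrite tfM.
Qed.
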